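(* Let $R$ be a noetherian ring and let $n$ be a positive integer. Then there is an isomorphism of $R[t_1,\ldots,t_n]$-algebras $$R(t_1, \ldots, t_n) \simeq R(t_1,\ldots,t_{n-1})(t_n).$$
   Context: For a ring $A$ and variables $t_1,\ldots,t_m$, let $U := \bigcap_{\mathfrak p \in \operatorname{Spec} A} (A[t_1,\ldots,t_m] \setminus \mathfrak p A[t_1,\ldots,t_m])$, a multiplicatively closed subset of the polynomial ring, and $A(t_1,\ldots,t_m) := U^{-1}A[t_1,\ldots,t_m]$. The right-hand side is this construction in the single variable $t_n$ applied to the ring $A = R(t_1,\ldots,t_{n-1})$. *)

(* Defs.v *)
From HB Require Import structures.
From mathcomp Require Import all_boot all_order all_algebra.
From mathcomp Require Import generic_quotient ring_quotient ring boolp.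
From mathcomp Require classical_sets.
From mathcomp Require Import mpoly.

Set Implicit Arguments.
Unset Strict Implicit.
Unset Printing Implicit Defensive.

Import GRing.Theory.
Local Open Scope ring_scope.
Local Open Scope quotient_scope.

Definition is_ideal (A : comNzRingType) (I : A -> Prop) : Prop :=
  [/\ I 0, forall u v, I u -> I v -> I (u + v) & forall a u, I u -> I (a * u)].

Definition noetherian (A : comNzRingType) : Prop :=
  forall I : A -> Prop, is_ideal I ->
  exists s : seq A, forall x,
    I x <-> exists c : 'I_(size s) -> A, x = \sum_i c i * s`_i.

(* The localization S^-1 A; the zero ring is allowed, hence comPzRingType. *)
Module Loc.
Section Loc.
Variables (A : comPzRingType) (S : mulrClosed A).

Definition ratio : Type := (A * {s : A | s \in S})%type.
HB.instance Definition _ := Choice.on ratio.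

Implicit Types x y z : ratio.
Local Notation num x := (x.1).
Local Notation den x := (sval x.2).

Definition eqv x y : bool :=
  `[< exists2 u, u \in S & u * (num x * den y) = u * (num y * den x) >].

Lemma eqvP x y : reflect
  (exists2 u, u \in S & u * (num x * den y) = u * (num y * den x)) (eqv x y).
Proof. exact: asboolP. Qed.

Lemma eqv_refl : reflexive eqv.
Proof. by move=> x; apply/eqvP; exists 1; rewrite ?rpred1. Qed.

Lemma eqv_sym : ssrbool.symmetric eqv.
Proof. by move=> x y; apply/eqvP/eqvP => -[u uS e]; exists u. Qed.

Lemma eqv_trans : transitive eqv.
Proof.
move=> y x z /eqvP[u uS exy] /eqvP[v vS eyz]; apply/eqvP.
exists (u * v * den y); first by rewrite !rpredM // (valP y.2).
have -> : u * v * den y * (num x * den z) = u * (num x * den y) * (v * den z).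
  by ring.
rewrite exy.
have -> : u * (num y * den x) * (v * den z) = v * (num y * den z) * (u * den x).
  by ring.
by rewrite eyz; ring.
Qed.

Canonical eqv_equiv := EquivRel eqv eqv_refl eqv_sym eqv_trans.

Definition type := {eq_quot eqv}.
HB.instance Definition _ : EqQuotient _ eqv type := EqQuotient.on type.
HB.instance Definition _ := Choice.on type.

Definition den1 : {s : A | s \in S} := exist _ 1 (rpred1 S).
Lemma denM_subproof (s t : {s : A | s \in S}) : sval s * sval t \in S.
Proof. by rewrite rpredM ?(valP s) ?(valP t). Qed.
Definition denM (s t : {s : A | s \in S}) : {s : A | s \in S} :=
  exist _ (sval s * sval t) (denM_subproof s t).

Lemma eqv_repr x : exists2 u, u \in S &
  u * (num x * den (repr (\pi_type x))) = u * (num (repr (\pi_type x)) * den x).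
Proof. by apply/eqvP; rewrite -[eqv _ _]/(eqv_equiv _ _) -eqmodE reprK. Qed.

Definition of_ring := lift_embed type (fun a : A => (a, den1) : ratio).
Canonical of_ring_pi_morph := PiEmbed of_ring.

Definition addf x y : ratio :=
  (num x * den y + num y * den x, denM x.2 y.2).
Definition add := lift_op2 type addf.

Lemma pi_add : {morph \pi : x y / addf x y >-> add x y}.
Proof.
move=> x y; unlock add; apply/eqmodP/eqvP.
have [u uS ex] := eqv_repr x; have [v vS ey] := eqv_repr y.
set x' := repr _ in ex *; set y' := repr _ in ey *.
exists (u * v); rewrite ?rpredM //=.
transitivity (u * (num x * den x') * (v * den y * den y') +
              v * (num y * den y') * (u * den x * den x')); first by ring.
by rewrite ex ey; ring.
Qed.
Canonical pi_add_morph := PiMorph2 pi_add.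

Definition oppf x : ratio := (- num x, x.2).
Definition opp := lift_op1 type oppf.

Lemma pi_opp : {morph \pi : x / oppf x >-> opp x}.
Proof.
move=> x; unlock opp; apply/eqmodP/eqvP.
have [u uS ex] := eqv_repr x; exists u => //=.
by rewrite !mulNr !mulrN ex.
Qed.
Canonical pi_opp_morph := PiMorph1 pi_opp.

Definition mulf x y : ratio := (num x * num y, denM x.2 y.2).
Definition mul := lift_op2 type mulf.

Lemma pi_mul : {morph \pi : x y / mulf x y >-> mul x y}.
Proof.
move=> x y; unlock mul; apply/eqmodP/eqvP.
have [u uS ex] := eqv_repr x; have [v vS ey] := eqv_repr y.
set x' := repr _ in ex *; set y' := repr _ in ey *.
exists (u * v); rewrite ?rpredM //=.
transitivity (u * (num x * den x') * (v * (num y * den y'))); first by ring.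
by rewrite ex ey; ring.
Qed.
Canonical pi_mul_morph := PiMorph2 pi_mul.

Lemma eqv_eq x y : num x * den y = num y * den x -> x = y %[mod type].
Proof. by move=> e; apply/eqmodP/eqvP; exists 1; rewrite ?rpred1 ?e. Qed.

Lemma addA : associative add.
Proof.
elim/quotW=> x; elim/quotW=> y; elim/quotW=> z; rewrite !piE.
by apply: eqv_eq => /=; ring.
Qed.

Lemma addC : commutative add.
Proof.
by elim/quotW=> x; elim/quotW=> y; rewrite !piE; apply: eqv_eq => /=; ring.
Qed.

Lemma add0 : left_id (of_ring 0) add.
Proof. by elim/quotW=> x; rewrite !piE; apply: eqv_eq => /=; ring. Qed.

Lemma addN : left_inverse (of_ring 0) opp add.
Proof. by elim/quotW=> x; rewrite !piE; apply: eqv_eq => /=; ring. Qed.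

HB.instance Definition _ := GRing.isZmodule.Build type addA addC add0 addN.

Lemma mulA : associative mul.
Proof.
elim/quotW=> x; elim/quotW=> y; elim/quotW=> z; rewrite !piE.
by apply: eqv_eq => /=; ring.
Qed.

Lemma mulC : commutative mul.
Proof.
by elim/quotW=> x; elim/quotW=> y; rewrite !piE; apply: eqv_eq => /=; ring.
Qed.

Lemma mul1 : left_id (of_ring 1) mul.
Proof. by elim/quotW=> x; rewrite !piE; apply: eqv_eq => /=; ring. Qed.

Lemma mulDl : left_distributive mul add.
Proof.
elim/quotW=> x; elim/quotW=> y; elim/quotW=> z; rewrite !piE.
by apply: eqv_eq => /=; ring.
Qed.

HB.instance Definition _ :=
  GRing.Zmodule_isComPzRing.Build type mulA mulC mul1 mulDl.

Lemma of_ring_zmod : zmod_morphism of_ring.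
Proof.
move=> a b; rewrite -[RHS]/(add (of_ring a) (opp (of_ring b))) !piE.
by apply: eqv_eq => /=; ring.
Qed.

HB.instance Definition _ := GRing.isZmodMorphism.Build A type of_ring
  of_ring_zmod.

Lemma of_ring_monoid : monoid_morphism of_ring.
Proof.
split=> [//|a b]; rewrite -[RHS]/(mul (of_ring a) (of_ring b)) !piE.
by apply: eqv_eq => /=; ring.
Qed.

HB.instance Definition _ := GRing.isMonoidMorphism.Build A type of_ring
  of_ring_monoid.

Lemma of_ring_eq0 a : (of_ring a = 0) <-> (exists2 u, u \in S & u * a = 0).
Proof.
rewrite -[0]/(of_ring 0) !piE; split.
  by move/eqmodP/eqvP=> [u uS]; rewrite /= mul0r mulr0 mulr1; exists u.
by move=> [u uS e]; apply/eqmodP/eqvP; exists u; rewrite //= mul0r mulr0 mulr1.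
Qed.

End Loc.
End Loc.
HB.export Loc.

Section PrimeFromProp.
Variables (A : comNzRingType) (I : A -> Prop).
Hypotheses (I_ideal : is_ideal I) (I1 : ~ I 1).
Hypothesis Iprime : forall u v, I (u * v) -> I u \/ I v.

Definition prime_pred : pred A := fun x => `[< I x >].

Lemma prime_pred_idealr : idealr_closed prime_pred.
Proof.
case: I_ideal => I0 ID IM; split.
- exact/asboolP.
- exact/asboolP.
- by move=> a u v /asboolP Iu /asboolP Iv; apply/asboolP/ID => //; apply: IM.
Qed.

Lemma prime_pred_prime : prime_idealr_closed prime_pred.
Proof.
by move=> u v /asboolP/Iprime[] ?; apply/orP; [left|right]; apply/asboolP.
Qed.

HB.instance Definition _ := isIdealr.Build A prime_pred prime_pred_idealr.
HB.instance Definition _ :=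
  isPrimeIdealrClosed.Build A prime_pred prime_pred_prime.

Definition prime_of_prop : prime_idealr A := prime_pred.

End PrimeFromProp.

Lemma exists_prime (A : comNzRingType) : inhabited (prime_idealr A).
Proof.
pose P (X : classical_sets.set A) :=
  [/\ ~ X 1, forall u v, X u -> X v -> X (u + v) & forall a u, X u -> X (a * u)].
have [F sFP Ftot|M [[M1 MD MM] Mmax]] := @classical_sets.Zorn_bigcup A P.
  split.
  - by move=> [X FX X1]; case: (sFP X FX).
  - move=> u v [X FX Xu] [Y FY Yv].
    have [sXY|sYX] := Ftot X Y FX FY.
      by exists Y => //; case: (sFP Y FY) => _ + _; apply=> //; apply: sXY.
    by exists X => //; case: (sFP X FX) => _ + _; apply=> //; apply: sYX.
  - by move=> a u [X FX Xu]; exists X => //; case: (sFP X FX) => _ _; apply.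
have M0 : M 0.
  apply: contrapT => nM0; pose M' : classical_sets.set A := fun x => x = 0.
  have noM x : ~ M x by move=> Mx; apply: nM0; rewrite -(mul0r x); apply: MM.
  apply: (Mmax M'); first by split=> [x /noM|/(_ 0 erefl)].
  split; rewrite /M'.
  - by move/eqP; rewrite oner_eq0.
  - by move=> u v -> ->; rewrite addr0.
  - by move=> a u ->; rewrite mulr0.
constructor; apply: (@prime_of_prop A M) => // u v Muv.
have [Mu|nMu] := pselect (M u); [by left|right].
pose M' : classical_sets.set A := fun x => exists m a, M m /\ x = m + a * u.
have [[m [a [Mm e]]]|nM'1] := pselect (M' 1).
  have -> : v = v * m + a * (u * v) by rewrite -[LHS]mulr1 e; ring.
  by apply: MD; apply: MM.
exfalso; apply: (Mmax M').
  split=> [x Mx|sM'M]; first by exists x, 0; rewrite mul0r addr0.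
  by apply: nMu; apply: sM'M; exists 0, 1; rewrite add0r mul1r.
split=> //.
- move=> _ _ [m [a [Mm ->]]] [m' [a' [Mm' ->]]].
  by exists (m + m'), (a + a'); split; [exact: MD | ring].
- move=> b _ [m [a [Mm ->]]].
  by exists (b * m), (b * a); split; [exact: MM | ring].
Qed.

Section Extension.
Variables (m : nat) (A : comNzRingType).

(* The ideal p A[t_1, ..., t_m] generated by the image of p. *)
Definition ext_ideal (p : {pred A}) (f : {mpoly A[m]}) : Prop :=
  exists2 s : seq (A * {mpoly A[m]}),
    {in s, forall x, x.1 \in p} & f = \sum_(x <- s) x.1%:MP * x.2.

Lemma ext_idealP (p : idealr A) (f : {mpoly A[m]}) :
  ext_ideal p f <-> forall k, f@_k \in p.
Proof.
split=> [[s sp ->] k|fp].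
  rewrite raddf_sum big_seq rpred_sum //= => x xs.
  by rewrite mcoeffCM mulrC idealMr // sp.
exists [seq (f@_k, 'X_[k]) | k <- msupp f].
  by move=> _ /mapP[k _ ->]; apply: fp.
rewrite big_map [LHS]mpolyE; apply: eq_bigr => k _ /=.
by rewrite mul_mpolyC.
Qed.

Lemma ext_ideal_prime (p : prime_idealr A) (f g : {mpoly A[m]}) :
  ext_ideal p (f * g) -> ext_ideal p f \/ ext_ideal p g.
Proof.
(* Remove the terms with coefficient in p, then look at leading terms. *)
have split_p (h : {mpoly A[m]}) : exists h1 h2 : {mpoly A[m]},
    [/\ h = h1 + h2, ext_ideal p h1 & h2 = 0 \/ mleadc h2 \notin p].
  pose h2 := \sum_(k <- msupp h | h@_k \notin p) h@_k *: 'X_[k].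
  have ch2 k : h2@_k = if h@_k \in p then 0 else h@_k.
    rewrite /h2 raddf_sum /= (eq_bigr (fun i => if i == k then h@_k else 0)).
      rewrite -big_mkcondr /=; case: ifPn => hk.
        by rewrite big1 // => i /andP[hi /eqP ei]; rewrite ei hk in hi.
      rewrite (eq_bigl (fun i => i == k)).
        rewrite -big_filter filter_pred1_uniq ?msupp_uniq ?big_seq1 //.
        by rewrite mcoeff_msupp; apply: contraNneq hk => ->; rewrite rpred0.
      by move=> i; case: eqP => [->|]; rewrite ?andbT ?andbF.
    move=> i _; rewrite mcoeffZ mcoeffX; case: eqP => [->|_].
      by rewrite mulr1.
    by rewrite mulr0.
  exists (h - h2), h2; split; first by rewrite subrK.
    apply/ext_idealP => k; rewrite mcoeffB ch2.
    by case: ifP => hk; rewrite ?subr0 ?subrr ?rpred0.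
  have [->|nz] := eqVneq h2 0; [by left|right].
  move: nz; rewrite -mleadc_eq0 ch2.
  by case: ifPn => //; rewrite eqxx.
have extD (h1 h2 : {mpoly A[m]}) :
    ext_ideal p h1 -> ext_ideal p h2 -> ext_ideal p (h1 + h2).
  move=> /ext_idealP e1 /ext_idealP e2; apply/ext_idealP => k.
  by rewrite mcoeffD rpredD.
have extM (h1 h2 : {mpoly A[m]}) : ext_ideal p h1 -> ext_ideal p (h2 * h1).
  move=> [s sp ->]; exists [seq (x.1, h2 * x.2) | x <- s].
    by move=> _ /mapP[x xs ->] /=; apply: sp.
  by rewrite big_map mulr_sumr; apply: eq_bigr => x _ /=; rewrite mulrCA.
have [f1 [f2 [-> pf1 [->|lf]]]] := split_p f; first by left; rewrite addr0.
have [g1 [g2 [-> pg1 [->|lg]]]] := split_p g; first by right; rewrite addr0.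
move=> pfg; exfalso.
have /ext_idealP/(_ (mlead f2 + mlead g2)%MM) : ext_ideal p (f2 * g2).
  have -> : f2 * g2 = (f1 + f2) * (g1 + g2)
      + ((- (g1 + g2)) * f1 + (- f2) * g1) by ring.
  by apply: (extD _ _) => //; apply: (extD _ _); apply: (extM _ _).
by rewrite mleadcM prime_idealrM (negPf lf) (negPf lg).
Qed.

End Extension.

Section Nagata.
Variables (m : nat) (A : comNzRingType).

(* The multiplicative set U. *)
Definition nagata_den : {pred {mpoly A[m]}} :=
  fun f => `[< forall p : prime_idealr A, ~ ext_ideal p f >].

Lemma nagata_denP (f : {mpoly A[m]}) :
  reflect (forall p : prime_idealr A, ~ ext_ideal p f) (f \in nagata_den).
Proof. exact: asboolP. Qed.

Lemma nagata_den_mulr_closed : mulr_closed nagata_den.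
Proof.
split; first apply/nagata_denP => p /ext_idealP/(_ 0%MM).
  by rewrite mcoeff1 eqxx idealr1.
move=> f g /nagata_denP Uf /nagata_denP Ug; apply/nagata_denP => p.
by move=> /ext_ideal_prime[]; [exact: Uf | exact: Ug].
Qed.

HB.instance Definition _ :=
  GRing.isMulClosed.Build {mpoly A[m]} nagata_den nagata_den_mulr_closed.

(* The ring A(t_1, ..., t_m). *)
Definition nagata : Type := Loc.type nagata_den.

HB.instance Definition _ := GRing.ComPzRing.on nagata.

Lemma nagata_nonzero : (1 : nagata) != 0.
Proof.
apply/eqP; rewrite -[1]/(Loc.of_ring nagata_den 1) => /Loc.of_ring_eq0[u].
move=> /nagata_denP Uu; rewrite mulr1 => u0.
have [p] := exists_prime A; apply: (Uu p).
by rewrite u0; apply/ext_idealP => k; rewrite mcoeff0 rpred0.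
Qed.

HB.instance Definition _ := GRing.PzSemiRing_isNonZero.Build nagata
  nagata_nonzero.

(* The structure map of A(t_1, ..., t_m) as an A[t_1, ..., t_m]-algebra. *)
Definition nagata_map : {mpoly A[m]} -> nagata := Loc.of_ring nagata_den.
HB.instance Definition _ := GRing.RMorphism.on nagata_map.

Definition nagata_const : A -> nagata := nagata_map \o @mpolyC m A.
HB.instance Definition _ := GRing.RMorphism.on nagata_const.

Definition nagata_var (i : 'I_m) : nagata := nagata_map 'X_i.

End Nagata.

Section Iterated.
Variables (n : nat) (R : comNzRingType).

(* The ring R(t_1, ..., t_n)(t_(n+1)). *)
Definition iter_nagata : comNzRingType := nagata 1 (nagata n R).

Definition iter_nagata_const : R -> iter_nagata :=
  nagata_const 1 (A := nagata n R) \o nagata_const n (A := R).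
HB.instance Definition _ := GRing.RMorphism.on iter_nagata_const.

(* [unlift ord_max i] is [Some j] when [i] is the index [j < n] seen in
   'I_n.+1, and [None] when [i] is the last index. *)
Definition iter_nagata_var (i : 'I_n.+1) : iter_nagata :=
  if unlift ord_max i is Some j then nagata_const 1 (nagata_var R j)
  else nagata_var (nagata n R) ord0.

(* The structure map making iter_nagata an R[t_1, ..., t_(n+1)]-algebra: the
   first n variables go to those of the inner ring, the last one to that of the
   outer ring. *)
Definition iter_nagata_map : {mpoly R[n.+1]} -> iter_nagata :=
  mmap iter_nagata_const iter_nagata_var.
HB.instance Definition _ := GRing.RMorphism.on iter_nagata_map.

End Iterated.

(* Main.v *)
Require Import Defs.
From HB Require Import structures.
From mathcomp Require Import all_boot all_order all_algebra.
From mathcomp Require Import generic_quotient ring_quotient ring boolp.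
From mathcomp Require Import mpoly.

(** Write [B] for [R(t_1, ..., t_n)].  Both rings are localizations of
    [R[t_1, ..., t_(n+1)]], so each side receives a map from the other as soon
    as the relevant denominators become invertible there; the two maps are then
    mutually inverse because they fix [R] and the variables
    ([mpoly_rmorph_eq], [Loc_rmorph_eq]).  Let [G] be the natural map
    [R[t_1, ..., t_(n+1)] -> B[t_(n+1)]].  Everything rests on the fact that a
    polynomial [f] is a denominator over [R] exactly when [G f] is one
    over [B].

    If [f] lies in the extension of a prime [p] of [R], then [G f] lies in the
    extension of the prime [p B], which is proper because no denominator of [B]
    lies in the extension of [p] ([nagata_extend_prime]); hence [G f] being a
    denominator forces [f] to be one ([nagata_den_of_widen_map]).

    Conversely, suppose that [G f] lies in the extension of a prime [q] of [B].
    When [n] is positive, substitute [t_1 ^ N] for [t_(n+1)], with [N] larger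
    than the degree of [f].  By Kronecker's trick distinct monomials of [f]
    stay distinct, so the result [h] has the same coefficients as [f] and is a
    denominator of [B] if [f] is one; but the substitution keeps [h] in [q],
    which then contains a unit.  When [n = 0] there is no variable to substitute
    into, and one contracts [q] to [R] instead
    ([nagata_den_widen_map]).

    Finally every denominator of [B[t_(n+1)]] becomes some [G f] after clearing
    the finitely many denominators of its coefficients ([clear_denominators]),
    so it is invertible in [R(t_1, ..., t_(n+1))]. *)

Set Implicit Arguments.
Unset Strict Implicit.
Unset Printing Implicit Defensive.

Import GRing.Theory.
Local Open Scope ring_scope.
Local Open Scope quotient_scope.

(** * Maps out of a localization *)

Section LocMaps.
Variables (A : comPzRingType) (S : mulrClosed A).

Lemma Loc_den_inv s : s \in S -> exists b, Loc.of_ring S s * b = 1.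
Proof.
move=> sS; exists (\pi_(Loc.type S) (1, exist _ s sS)).
rewrite -[LHS]/(Loc.mul _ _) -[RHS]/(Loc.of_ring S 1) !piE.
by apply: Loc.eqv_eq => /=; ring.
Qed.

Lemma Loc_fraction (x : Loc.type S) :
  exists a s, s \in S /\ x * Loc.of_ring S s = Loc.of_ring S a.
Proof.
elim/quotW: x => -[a [s sS]]; exists a, s; split=> //.
rewrite -[LHS]/(Loc.mul _ _) !piE.
by apply: Loc.eqv_eq => /=; ring.
Qed.

Lemma Loc_of_ring_eq a b : Loc.of_ring S a = Loc.of_ring S b ->
  exists2 u, u \in S & u * a = u * b.
Proof.
move=> e; have /Loc.of_ring_eq0[u uS] : Loc.of_ring S (a - b) = 0.
  by rewrite rmorphB /= e subrr.
by rewrite mulrBr => /eqP; rewrite subr_eq0 => /eqP; exists u.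
Qed.

(** Inverses are unique, so the value at a fraction is determined by the values
    at its numerator and denominator. *)
Lemma Loc_rmorph_eq (C : comPzRingType) (f g : {rmorphism Loc.type S -> C}) :
  (forall a, f (Loc.of_ring S a) = g (Loc.of_ring S a)) -> f =1 g.
Proof.
move=> fg x; have [a [s [sS e]]] := Loc_fraction x.
have [b sb] := Loc_den_inv sS.
have fsb : f (Loc.of_ring S s) * f b = 1 by rewrite -rmorphM sb rmorph1.
rewrite -[f x]mulr1 -[g x]mulr1 -fsb !mulrA -rmorphM e fg.
by rewrite [f (Loc.of_ring S s)]fg -rmorphM e.
Qed.

(** The target is only a commutative ring, without an inverse operation, so the
    inverses of the images of the denominators are picked by choice; they are
    unique, which is why the resulting map is additive and multiplicative. *)
Lemma Loc_lift (C : comPzRingType) (f : {rmorphism A -> C}) :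
    (forall s, s \in S -> exists b, f s * b = 1) ->
  exists phi : {rmorphism Loc.type S -> C},
    forall a, phi (Loc.of_ring S a) = f a.
Proof.
move=> fS; pose inv (s : {s | s \in S}) := projT1 (cid (fS _ (valP s))).
have invP s : f (sval s) * inv s = 1 by rewrite /inv; case: cid.
have cancel s (x y : C) : s \in S -> f s * x = f s * y -> x = y.
  move=> /fS[b sb] e; rewrite -[x]mul1r -[y]mul1r -sb [f s * b]mulrC.
  by rewrite -!mulrA e.
pose phi (y : Loc.type S) := f (repr y).1 * inv (repr y).2.
have phi_pi x : phi (\pi x) = f x.1 * inv x.2.
  rewrite /phi; have [u uS] := Loc.eqv_repr x.
  move: (repr _) => y e; apply: (cancel u) => //.
  apply: (cancel (sval x.2)); first exact: valP.
  apply: (cancel (sval y.2)); first exact: valP.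
  transitivity (f (u * (y.1 * sval x.2)) * (f (sval y.2) * inv y.2)).
    by rewrite !rmorphM /=; ring.
  rewrite invP -(invP x.2) -e !rmorphM /=; ring.
have phi_of_ring a : phi (Loc.of_ring S a) = f a.
  rewrite !piE phi_pi /=.
  by have := invP (Loc.den1 S); rewrite /= rmorph1 mul1r => ->; rewrite mulr1.
have phi_zmod : zmod_morphism phi.
  elim/quotW=> x; elim/quotW=> y.
  rewrite -[_ - _]/(Loc.add _ (Loc.opp _)) !piE !phi_pi /=.
  apply: (cancel (sval x.2 * sval y.2)); first exact: valP (Loc.denM x.2 y.2).
  have := invP (Loc.denM x.2 y.2); rewrite /= => e.
  rewrite mulrCA e mulr1 !(rmorphM, rmorphD, rmorphN) /=.
  transitivity (f x.1 * f (sval y.2) * 1 - f y.1 * f (sval x.2) * 1).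
    by ring.
  by rewrite -{1}(invP x.2) -(invP y.2); ring.
have phi_monoid : monoid_morphism phi.
  split; first by rewrite -[1 in LHS]/(Loc.of_ring S 1) phi_of_ring rmorph1.
  elim/quotW=> x; elim/quotW=> y.
  rewrite -[X in phi X]/(Loc.mul _ _) !piE !phi_pi /=.
  apply: (cancel (sval x.2 * sval y.2)); first exact: valP (Loc.denM x.2 y.2).
  have := invP (Loc.denM x.2 y.2); rewrite /= => e.
  rewrite mulrCA e mulr1 !rmorphM /=.
  transitivity (f x.1 * f y.1 * (1 * 1)); first by ring.
  by rewrite -{1}(invP x.2) -(invP y.2); ring.
pose zM := GRing.isZmodMorphism.Build _ _ phi phi_zmod.
pose mM := GRing.isMonoidMorphism.Build _ _ phi phi_monoid.
pose phiM : {rmorphism Loc.type S -> C} := HB.pack phi zM mM.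
by exists phiM.
Qed.

End LocMaps.

(** * Polynomials and extended ideals *)

Lemma mpoly_rmorph_eq (m : nat) (A C : comNzRingType)
    (f g : {rmorphism {mpoly A[m]} -> C}) :
  (forall c, f c%:MP = g c%:MP) -> (forall i, f 'X_i = g 'X_i) -> f =1 g.
Proof.
move=> fgC fgX p; rewrite [p]mpolyE !rmorph_sum /=; apply: eq_bigr => k _.
rewrite -mul_mpolyC !rmorphM /= fgC mpolyXE_id; congr (_ * _).
by rewrite !rmorph_prod; apply: eq_bigr => i _; rewrite !rmorphXn /= fgX.
Qed.

Section ExtIdeal.
Variables (m : nat) (A : comNzRingType).

Lemma ext_idealD (p : idealr A) (f g : {mpoly A[m]}) :
  ext_ideal p f -> ext_ideal p g -> ext_ideal p (f + g).
Proof.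
move=> /ext_idealP pf /ext_idealP pg; apply/ext_idealP => k.
by rewrite mcoeffD rpredD.
Qed.

Lemma ext_idealM (p : {pred A}) (f g : {mpoly A[m]}) :
  ext_ideal p f -> ext_ideal p (g * f).
Proof.
move=> [s sp ->]; exists [seq (x.1, g * x.2) | x <- s].
  by move=> _ /mapP[x xs ->] /=; apply: sp.
by rewrite big_map mulr_sumr; apply: eq_bigr => x _ /=; rewrite mulrCA.
Qed.

Lemma ext_idealC (p : {pred A}) (a : A) : a \in p -> ext_ideal p a%:MP_[m].
Proof.
move=> pa; exists [:: (a, 1)]; first by move=> x /[1!inE]/eqP->.
by rewrite big_seq1 mulr1.
Qed.

Lemma ext_ideal_map (m' : nat) (A' : comNzRingType) (p : {pred A})
    (q : {pred A'}) (i : A -> A')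
    (F : {rmorphism {mpoly A[m]} -> {mpoly A'[m']}}) f :
    (forall a, F a%:MP = (i a)%:MP) -> {in p, forall a, i a \in q} ->
  ext_ideal p f -> ext_ideal q (F f).
Proof.
move=> Fi pq [s sp ->]; exists [seq (i x.1, F x.2) | x <- s].
  by move=> _ /mapP[x xs ->] /=; apply/pq/sp.
by rewrite big_map rmorph_sum; apply: eq_bigr => x _; rewrite rmorphM /= Fi.
Qed.

(** Evaluating at a point of [A] turns [q A[t]] into [q]. *)
Lemma ext_ideal_eval (q : idealr A) (F : {rmorphism {mpoly A[m]} -> A}) f :
  (forall a, F a%:MP = a) -> ext_ideal q f -> F f \in q.
Proof.
move=> FC [s sq ->]; rewrite rmorph_sum big_seq rpred_sum //= => x xs.
by rewrite rmorphM /= FC mulrC idealMr ?sq.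
Qed.

End ExtIdeal.

(** * Primes of [R] and of [R(t_1, ..., t_n)] *)

Section NagataPrimes.
Variables (n : nat) (R : comNzRingType).

Lemma nagata_den_inv f :
  f \in @nagata_den n R -> exists b, nagata_map f * b = 1.
Proof. exact: Loc_den_inv. Qed.

Lemma nagata_fraction (x : nagata n R) : exists a s,
  s \in @nagata_den n R /\ x * nagata_map s = nagata_map a.
Proof. exact: Loc_fraction. Qed.

(** The prime is [p B], the set of fractions whose numerator can be taken in the
    extension [P] of [p]. *)
Lemma nagata_extend_prime (p : prime_idealr R) :
  exists q : prime_idealr (nagata n R),
    {in p, forall a, nagata_const n a \in q}.
Proof.
pose I (x : nagata n R) := exists a s, [/\ ext_ideal p a, s \in @nagata_den n R
  & x * nagata_map s = nagata_map a].
have nat_eq (a b : {mpoly R[n]}) : nagata_map a = nagata_map b ->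
    exists2 u, u \in @nagata_den n R & u * a = u * b.
  exact: Loc_of_ring_eq.
have I_ideal : is_ideal I.
  split.
  - exists 0, 1; split; rewrite ?rpred1 ?mul0r ?rmorph0 //.
    by apply/ext_idealP => k; rewrite mcoeff0 rpred0.
  - move=> x y [a [s [pa sU ea]]] [b [t [pb tU eb]]].
    exists (t * a + s * b), (s * t); split; rewrite ?rpredM //.
      by apply: ext_idealD; apply: ext_idealM.
    by rewrite rmorphD !rmorphM /= -ea -eb; ring.
  - move=> y x [a [s [pa sU ea]]]; have [b [t [tU eb]]] := nagata_fraction y.
    exists (b * a), (t * s); split; rewrite ?rpredM //.
      exact: ext_idealM.
    by rewrite !rmorphM /= -ea -eb; ring.
have I1 : ~ I 1.
  move=> [a [s [pa sU]]]; rewrite mul1r => /nat_eq[u uU e].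
  have /nagata_denP/(_ p) : u * s \in @nagata_den n R by rewrite rpredM.
  by rewrite e; apply; apply: ext_idealM.
have Iprime x y : I (x * y) -> I x \/ I y.
  move=> [c [w [pc wU ec]]].
  have [a [s [sU ea]]] := nagata_fraction x.
  have [b [t [tU eb]]] := nagata_fraction y.
  have /nat_eq[u uU e] : nagata_map (w * (a * b)) = nagata_map (s * t * c).
    by rewrite !rmorphM /= -ea -eb -ec; ring.
  have : ext_ideal p (u * w * (a * b)).
    by rewrite -mulrA e; do 2![apply: ext_idealM].
  case/ext_ideal_prime => [puw|].
    have /nagata_denP/(_ p) : u * w \in @nagata_den n R by rewrite rpredM.
    by case.
  by case/ext_ideal_prime => ?; [left; exists a, s | right; exists b, t].
exists (prime_of_prop I_ideal I1 Iprime) => a pa; apply/asboolP.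
exists a%:MP, 1; split; rewrite ?rpred1 ?rmorph1 ?mulr1 //.
exact: ext_idealC.
Qed.

Lemma nagata_contract_prime (q : prime_idealr (nagata n R)) :
  exists p : prime_idealr R, forall a, (a \in p) = (nagata_const n a \in q).
Proof.
pose I (a : R) : Prop := nagata_const n a \in q.
have I_ideal : is_ideal I.
  split; rewrite /I; first by rewrite rmorph0 rpred0.
    by move=> u v qu qv; rewrite rmorphD rpredD.
  by move=> a u qu; rewrite rmorphM idealMr.
have I1 : ~ I 1 by rewrite /I rmorph1 idealr1.
have Iprime u v : I (u * v) -> I u \/ I v.
  by rewrite /I rmorphM prime_idealrM => /orP.
by exists (prime_of_prop I_ideal I1 Iprime) => a; apply/asboolP/idP.
Qed.

End NagataPrimes.

(** * Kronecker substitution *)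

Section Kronecker.
Variables (n : nat) (R : comNzRingType) (N : nat).

Definition kronecker_var (i : 'I_n.+2) : {mpoly R[n.+1]} :=
  if unlift ord_max i is Some j then 'X_j else 'X_ord0 ^+ N.

Definition kronecker : {mpoly R[n.+2]} -> {mpoly R[n.+1]} :=
  mmap (@mpolyC n.+1 R) kronecker_var.
HB.instance Definition _ := GRing.RMorphism.on kronecker.

Definition kronecker_mnm (k : 'X_{1..n.+2}) : 'X_{1..n.+1} :=
  [multinom (k (lift ord_max j) + (j == ord0) * (N * k ord_max))%N | j < n.+1].

Lemma mmap1_kronecker k : mmap1 kronecker_var k = 'X_[kronecker_mnm k].
Proof.
rewrite /mmap1 (bigD1_ord ord_max) //= /kronecker_var unlift_none -exprM.
rewrite [in RHS]mpolyXE_id.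
rewrite (eq_bigr (fun j => 'X_j ^+ k (lift ord_max j))); last first.
  by move=> j _; rewrite liftK.
rewrite [in RHS](eq_bigr (fun j => 'X_j ^+ ((j == ord0) * (N * k ord_max)) *
   'X_j ^+ k (lift ord_max j))); last first.
  by move=> j _; rewrite mnmE exprD mulrC.
rewrite big_split /=; congr (_ * _).
rewrite (bigD1 ord0) //= mul1n big1 ?mulr1 // => j /negPf->.
by rewrite mul0n expr0.
Qed.

(** Below degree [N] the exponents of [t_1] and of the last variable are the
    remainder and the quotient in a division by [N]. *)
Lemma kronecker_mnm_inj (k l : 'X_{1..n.+2}) :
  (mdeg k < N)%N -> (mdeg l < N)%N ->
  kronecker_mnm k = kronecker_mnm l -> k = l.
Proof.
move=> kN lN e.
have small (x : 'X_{1..n.+2}) i : (mdeg x < N -> x i < N)%N.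
  by apply: leq_ltn_trans; rewrite mdegE (bigD1 i) //= leq_addr.
have N0 : (0 < N)%N by apply: leq_ltn_trans kN.
have e0 := congr1 (fun x : 'X_{1..n.+1} => x ord0) e.
rewrite !mnmE !mul1n in e0.
have em : k (lift ord_max ord0) = l (lift ord_max ord0).
  have := congr1 (modn^~ N) e0.
  rewrite ![(N * _)%N]mulnC ![(_ + _ * N)%N]addnC !modnMDl.
  by rewrite !modn_small ?small.
have ed : k ord_max = l ord_max.
  by move/eqP: e0; rewrite em eqn_add2l eqn_pmul2l // => /eqP.
apply/mnmP => i; case: (unliftP ord_max i) => [j|] -> //.
have := congr1 (fun x : 'X_{1..n.+1} => x j) e; rewrite !mnmE ed.
by move/addIn.
Qed.

Lemma mcoeff_kronecker (f : {mpoly R[n.+2]}) k : (msize f <= N)%N ->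
  k \in msupp f -> (kronecker f)@_(kronecker_mnm k) = f@_k.
Proof.
move=> fN kf; rewrite /kronecker /mmap raddf_sum /=.
rewrite (bigD1_seq k) ?msupp_uniq //= mmap1_kronecker mcoeffCM mcoeffX eqxx.
rewrite mulr1 big_seq_cond big1 ?addr0 // => l /andP[lf lk].
rewrite mmap1_kronecker mcoeffCM mcoeffX; case: eqP => [e|]; rewrite ?mulr0 //.
case/eqP: lk; apply: kronecker_mnm_inj e.
  exact: leq_trans (msize_mdeg_lt lf) fN.
exact: leq_trans (msize_mdeg_lt kf) fN.
Qed.

(** Every coefficient of [f] is a coefficient of its substitution, so a prime
    containing all coefficients of the latter contains those of [f]. *)
Lemma kronecker_nagata_den (f : {mpoly R[n.+2]}) : (msize f <= N)%N ->
  f \in @nagata_den n.+2 R -> kronecker f \in @nagata_den n.+1 R.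
Proof.
move=> fN /nagata_denP fU; apply/nagata_denP => p /ext_idealP pf; apply: (fU p).
apply/ext_idealP => k; have [kf|] := boolP (k \in msupp f).
  by rewrite -mcoeff_kronecker.
by move/memN_msupp_eq0->; rewrite rpred0.
Qed.

End Kronecker.

(** * Denominators over [R] and over [R(t_1, ..., t_n)] *)

Section Widen.
Variables (n : nat) (R : comNzRingType).
Local Notation B := (nagata n R).

Definition widen_map_var (i : 'I_n.+1) : {mpoly B[1]} :=
  if unlift ord_max i is Some j then (nagata_var R j)%:MP else 'X_ord0.

(** The map [G] from [R[t_1, ..., t_(n+1)]] to [B[t_(n+1)]]. *)
Definition widen_map : {mpoly R[n.+1]} -> {mpoly B[1]} :=
  mmap (@mpolyC 1 B \o nagata_const n (A := R)) widen_map_var.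
HB.instance Definition _ := GRing.RMorphism.on widen_map.

Lemma widen_mapC c : widen_map c%:MP = (nagata_const n c)%:MP.
Proof. by rewrite /widen_map mmapC. Qed.

Lemma widen_mapX i : widen_map 'X_i = widen_map_var i.
Proof. by rewrite /widen_map mmapX mmap1U. Qed.

Lemma lift_ord_max (i : 'I_n) :
  widen_ord (leqnSn n) i = lift (@ord_max n) i.
Proof. by apply/val_inj; rewrite /= /bump leqNgt ltn_ord. Qed.

Lemma mwiden_Xi i : mwiden 'X_i = 'X_(lift ord_max i) :> {mpoly R[n.+1]}.
Proof. by rewrite /mwiden mmapX mmap1U -lift_ord_max. Qed.

Lemma widen_map_mwiden a : widen_map (mwiden a) = (nagata_map a)%:MP.
Proof.
apply: (mpoly_rmorph_eq (f := widen_map \o @mwiden n R)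
  (g := @mpolyC 1 B \o @nagata_map n R)) => [c|i] /=.
  by rewrite mwidenC widen_mapC.
by rewrite mwiden_Xi widen_mapX /widen_map_var liftK.
Qed.

Lemma iter_nagata_mapE f : iter_nagata_map f = nagata_map (widen_map f).
Proof.
apply: (mpoly_rmorph_eq (f := @iter_nagata_map n R)
  (g := @nagata_map 1 B \o widen_map)) => [c|i] /=.
  by rewrite /iter_nagata_map mmapC widen_mapC.
rewrite /iter_nagata_map mmapX mmap1U widen_mapX /iter_nagata_var.
by rewrite /widen_map_var; case: (unlift _ _).
Qed.

(** Setting the last variable to zero gives back the original polynomial. *)
Lemma mwiden_nagata_den (s : {mpoly R[n]}) :
  s \in @nagata_den n R -> mwiden s \in @nagata_den n.+1 R.
Proof.
move=> /nagata_denP sU; apply/nagata_denP => p ps; apply: (sU p).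
pose F : {rmorphism {mpoly R[n.+1]} -> {mpoly R[n]}} :=
  mmap (@mpolyC n R) (fun i => if unlift ord_max i is Some j then 'X_j else 0).
have FC a : F a%:MP = a%:MP by rewrite /F /= mmapC.
have <- : F (mwiden s) = s.
  apply: (mpoly_rmorph_eq (f := F \o @mwiden n R) (g := idfun)) => [c|i].
    by rewrite /= mwidenC mmapC.
  by rewrite /= mwiden_Xi mmapX mmap1U liftK.
by apply: (ext_ideal_map (i := id) (F := F)) ps.
Qed.

(** A prime [p] of [R] at which [f] fails to be a denominator yields the prime
    [p B], at which the image of [f] fails too. *)
Lemma nagata_den_of_widen_map f :
  widen_map f \in @nagata_den 1 B -> f \in @nagata_den n.+1 R.
Proof.
move=> /nagata_denP fU; apply/nagata_denP => p pf.
have [q pq] := nagata_extend_prime n p; apply: (fU q).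
by apply: (ext_ideal_map (F := widen_map) widen_mapC pq).
Qed.

(** One denominator is cleared per monomial of [v]; a sum of two polynomials is
    treated by multiplying their denominators. *)
Lemma clear_denominators (v : {mpoly B[1]}) : exists s w,
  s \in @nagata_den n R /\ (nagata_map s)%:MP * v = widen_map w.
Proof.
rewrite [v]mpolyE; elim/big_ind: _ => [|x y|k _].
- by exists 1, 0; rewrite rpred1 mulr0 rmorph0.
- move=> [s [w [sU ew]]] [t [z [tU ez]]].
  exists (s * t), (mwiden t * w + mwiden s * z); split; first exact: rpredM.
  rewrite rmorphD !(rmorphM widen_map) /= !widen_map_mwiden -ew -ez.
  by rewrite rmorphM /= mpolyCM; ring.
- have [a [s [sU e]]] := nagata_fraction v@_k.
  exists s, (mwiden a * 'X_ord_max ^+ k ord0); split; first exact: sU.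
  rewrite rmorphM rmorphXn /= widen_map_mwiden -e widen_mapX /widen_map_var.
  rewrite unlift_none mpolyXE_id big_ord1 -mul_mpolyC mpolyCM; ring.
Qed.

End Widen.

(** For positive [n], evaluation at [t_1 ^ N] carries the image of [f] to the
    image in [B] of its Kronecker substitution, which is a unit and so lies in no
    prime of [B]. *)
Lemma nagata_den_widen_map (n : nat) (R : comNzRingType) f :
  f \in @nagata_den n.+1 R -> widen_map f \in @nagata_den 1 (nagata n R).
Proof.
move=> fU; apply/nagata_denP => q qf.
case: n => [|n] in f fU q qf *.
  (* Without a variable [t_1], the coefficients of the image of [f] are those of
     [f] itself, so a contracted prime suffices. *)
  have [p pq] := nagata_contract_prime q.
  have e : map_mpoly (nagata_const 0 (A := R)) f = widen_map f.
    apply: (mpoly_rmorph_eq (f := map_mpoly (nagata_const 0 (A := R)))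
      (g := @widen_map 0 R)) => [c|i].
      by rewrite [LHS]map_mpolyC [RHS]widen_mapC.
    rewrite [LHS]mmapX mmap1U [RHS]widen_mapX /widen_map_var.
    by case: (unliftP ord_max i) => [[]//|_]; rewrite ord1.
  move/nagata_denP/(_ p): fU; apply; apply/ext_idealP => k; rewrite pq.
  rewrite -[X in X \in _](mcoeff_map_mpoly (nagata_const 0 (A := R))) e.
  by move/ext_idealP: qf; apply.
pose N := msize f.
pose F : {rmorphism {mpoly (nagata n.+1 R)[1]} -> nagata n.+1 R} :=
  mmap idfun (fun=> nagata_map ('X_ord0 ^+ N)).
have FC a : F a%:MP = a by rewrite /F /= mmapC.
have e : F (widen_map f) = nagata_map (kronecker N f).
  apply: (mpoly_rmorph_eq (f := F \o @widen_map n.+1 R)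
    (g := @nagata_map n.+1 R \o @kronecker n R N)) => [c|i].
    by rewrite /= widen_mapC mmapC /kronecker mmapC.
  rewrite /= widen_mapX /widen_map_var /kronecker (mmapX _ _ U_(i)) mmap1U.
  rewrite /kronecker_var; case: (unlift _ _) => [j|]; first by rewrite mmapC.
  by rewrite mmapX mmap1U.
have [b hb] := nagata_den_inv (kronecker_nagata_den (leqnn N) fU).
have : 1 \in q by rewrite -hb mulrC idealMr // -e; apply: ext_ideal_eval.
by rewrite idealr1.
Qed.

(** * The two mutually inverse maps *)

Theorem proposition3p8 (R : comNzRingType) (n : nat) (hR : noetherian R) :
  exists phi : {rmorphism nagata n.+1 R -> iter_nagata n R},
    bijective phi /\
    forall f : {mpoly R[n.+1]}, phi (nagata_map f) = iter_nagata_map f.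
Proof.
have [phi phiE] : exists phi : {rmorphism nagata n.+1 R -> iter_nagata n R},
    forall f, phi (nagata_map f) = iter_nagata_map f.
  apply: (Loc_lift (f := @iter_nagata_map n R)) => f fU.
  rewrite /= iter_nagata_mapE; apply: nagata_den_inv.
  exact: nagata_den_widen_map.
have [theta thetaE] : exists theta : {rmorphism nagata n R -> nagata n.+1 R},
    forall a, theta (nagata_map a) = nagata_map (mwiden a).
  apply: (Loc_lift (f := @nagata_map n.+1 R \o @mwiden n R)) => s sU.
  exact/nagata_den_inv/mwiden_nagata_den.
pose eta : {rmorphism {mpoly (nagata n R)[1]} -> nagata n.+1 R} :=
  mmap theta (fun=> nagata_map 'X_ord_max).
have etaC c : eta c%:MP = theta c by rewrite /eta /= mmapC.
have etaX i : eta 'X_i = nagata_map 'X_ord_max by rewrite /eta /= mmapX mmap1U.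
have eta_widen f : eta (widen_map f) = nagata_map f.
  apply: (mpoly_rmorph_eq (f := eta \o @widen_map n R)
    (g := @nagata_map n.+1 R)) => [c|i].
    by rewrite [LHS]/= widen_mapC etaC thetaE mwidenC.
  rewrite [LHS]/= widen_mapX /widen_map_var.
  case: (unliftP ord_max i) => [j|] ->; last exact: etaX.
  by rewrite etaC thetaE mwiden_Xi.
have [psi psiE] : exists psi : {rmorphism iter_nagata n R -> nagata n.+1 R},
    forall g, psi (nagata_map g) = eta g.
  apply: (Loc_lift (f := eta)) => v vU.
  (* The image of [s v = G w] is that of [w], a denominator over [R]; a divisor
     of a unit is a unit. *)
  have [s [w [sU e]]] := clear_denominators v.
  have sB : (nagata_map s)%:MP \in @nagata_den 1 (nagata n R).
    rewrite -widen_map_mwiden; apply: nagata_den_widen_map.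
    exact: mwiden_nagata_den.
  have wU : w \in @nagata_den n.+1 R.
    by apply: nagata_den_of_widen_map; rewrite -e rpredM.
  have [b wb] := nagata_den_inv wU; exists (eta (nagata_map s)%:MP * b).
  by rewrite mulrA -rmorphM [v * _]mulrC e eta_widen.
exists phi; split=> //; exists psi.
  apply: (Loc_rmorph_eq (f := psi \o phi) (g := idfun)) => f.
  by rewrite [LHS]/= phiE iter_nagata_mapE psiE eta_widen.
apply: (Loc_rmorph_eq (f := phi \o psi) (g := idfun)) => g.
rewrite [LHS]/= psiE.
apply: (mpoly_rmorph_eq (f := phi \o eta)
  (g := @nagata_map 1 (nagata n R))) => [c|i]; rewrite [LHS]/=.
  rewrite etaC.
  pose const : {rmorphism nagata n R -> iter_nagata n R} :=
    nagata_const 1 (A := nagata n R).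
  rewrite -[RHS]/(const c).
  apply: (Loc_rmorph_eq (f := phi \o theta) (g := const)) => a.
  rewrite -[LHS]/(phi (theta (nagata_map a))) thetaE phiE iter_nagata_mapE.
  by rewrite widen_map_mwiden.
rewrite -/(eta _) etaX phiE iter_nagata_mapE widen_mapX /widen_map_var.
by rewrite unlift_none [i]ord1.
Qed.
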